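(* Every non-Lie Leibniz algebra of the set $L(4,2)$ admits a basis $\{N_{12},N_{23},N_{34},N_{13},N_{24},N_{14},X^1,X^2\}$ in which the products among the $N_{ij}$ are those of $T(4)$, and the products involving $X^1,X^2$ are, for some $\sigma^{11},\sigma^{22},\sigma^{12},\sigma^{21}\in\mathbb{C}$, $$[N_{12},X^1]=-[X^1,N_{12}]=N_{12},\quad [N_{34},X^1]=-[X^1,N_{34}]=-N_{34},$$ $$[N_{13},X^1]=-[X^1,N_{13}]=N_{13},\quad [N_{24},X^1]=-[X^1,N_{24}]=-N_{24},$$ $$[N_{23},X^2]=-[X^2,N_{23}]=N_{23},\quad [N_{34},X^2]=-[X^2,N_{34}]=-N_{34},$$ $$[N_{13},X^2]=-[X^2,N_{13}]=N_{13},\quad [X^1,X^1]=\sigma^{11}N_{14},$$ $$[X^2,X^2]=\sigma^{22}N_{14},\quad [X^1,X^2]=\sigma^{12}N_{14},\quad [X^2,X^1]=\sigma^{21}N_{14},$$ all omitted products involving $X^1$ or $X^2$ being zero.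
   Context: All vector spaces and algebras are finite-dimensional over $\mathbb{C}$. A (right) Leibniz algebra is an algebra $(L,[-,-])$ satisfying $[x,[y,z]]=[[x,y],z]-[[x,z],y]$ for all $x,y,z\in L$. The lower central series is $L^1=L$, $L^{k+1}=[L^k,L]$ and the derived series is $L^{[1]}=L$, $L^{[s+1]}=[L^{[s]},L^{[s]}]$; $L$ is nilpotent (resp. solvable) if $L^{k}=0$ (resp. $L^{[m]}=0$) for some $k$ (resp. $m$). The nilradical of $L$ is its maximal nilpotent (two-sided) ideal. $T(4)$ denotes the Lie algebra of strictly upper triangular $4\times 4$ complex matrices, with basis $\{N_{ij} : 1\le i<j\le 4\}$ (matrix units) and products $[N_{ij},N_{kl}]=\delta_{jk}N_{il}-\delta_{il}N_{kj}$. $L(4,2)$ denotes the set of all non-nilpotent solvable Leibniz algebras with nilradical $T(4)$ and a two-dimensional complementary vector space $\langle X^1,X^2\rangle$ to the nilradical. ''Non-Lie'' means that the Leibniz algebra is not a Lie algebra. In $X^1,X^2,\sigma^{\alpha\beta}$ the superscripts are indices, not powers. *)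

(* Defs.v *)
From HB Require Import structures.
From mathcomp Require Import all_boot all_order all_algebra.
From mathcomp Require Export complex.
From mathcomp Require Import reals.

Set Implicit Arguments.
Unset Strict Implicit.
Unset Printing Implicit Defensive.

Import GRing.Theory.
Local Open Scope ring_scope.

Section Algebras.
Variables (F : fieldType) (L : vectType F).
Implicit Types (br : L -> L -> L) (U V I N Q : {vspace L}).

(* Right Leibniz identity: right multiplications are derivations. *)
Definition leibniz br :=
  forall x y z, br x (br y z) = br (br x y) z - br (br x z) y.

Definition lie br :=
  (forall x, br x x = 0) /\
  (forall x y z, br x (br y z) + br y (br z x) + br z (br x y) = 0).

(* [U, V], the span of all products; products of basis vectors are enough when
   br is bilinear (lemmas memv_bracketv and bracketv_subP). *)
Definition bracketv br U V : {vspace L} :=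
  <<[seq br u v | u <- vbasis U, v <- vbasis V]>>%VS.

(* Indices are shifted by one: [lower_central br U k] is U^(k+1) and
   [derived_series br U k] is U^[k+1]. *)
Definition lower_central br U (k : nat) : {vspace L} :=
  iter k (fun W => bracketv br W U) U.

Definition derived_series br U (k : nat) : {vspace L} :=
  iter k (fun W => bracketv br W W) U.

Definition nilpotentv br U := exists k, lower_central br U k = 0%VS.
Definition solvablev br U := exists k, derived_series br U k = 0%VS.

Definition ideal br I :=
  forall x y, x \in I -> (br x y \in I) && (br y x \in I).

(* "Maximal" is with respect to inclusion. *)
Definition nilradical br N :=
  [/\ ideal br N, nilpotentv br N &
      forall I, ideal br I -> nilpotentv br I -> (N <= I)%VS -> I = N].

End Algebras.

(* Isomorphism of the subalgebra U of (A, brA) with the subalgebra V of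
   (B, brB).  A linear map defined on U only extends to A, so there is no loss
   in quantifying over maps defined on the whole of A. *)
Definition isomorphic_algebras (F : fieldType) (A B : vectType F)
    (brA : A -> A -> A) (U : {vspace A})
    (brB : B -> B -> B) (V : {vspace B}) :=
  exists f : 'Hom(A, B),
    [/\ (U :&: lker f)%VS = 0%VS, (f @: U)%VS = V &
        forall x y, x \in U -> y \in U -> f (brA x y) = brB (f x) (f y)].

Definition commutator (F : fieldType) (n : nat) (A B : 'M[F]_n) : 'M[F]_n :=
  A *m B - B *m A.

(* Strictly upper triangular 4 x 4 matrices, as the span of matrix units. *)
Definition T4 (F : fieldType) : {vspace 'M[F]_4} :=
  (\sum_(p : 'I_4 * 'I_4 | (p.1 < p.2)%N) <[delta_mx p.1 p.2]>)%VS.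

(* The products of the matrix units of T(4); rows and columns are numbered from
   1 to 4, and the values of E at other pairs of indices are irrelevant (in each
   term with a nonzero coefficient the indices are again in range). *)
Definition T4_products (F : fieldType) (L : vectType F) (br : L -> L -> L)
    (E : nat -> nat -> L) :=
  forall i j k l : nat,
    (1 <= i < j)%N -> (j <= 4)%N -> (1 <= k < l)%N -> (l <= 4)%N ->
    br (E i j) (E k l) = (j == k)%:R *: E i l - (i == l)%:R *: E k j.

Definition in_L42 (F : fieldType) (L : vectType F) (br : L -> L -> L) :=
  [/\ leibniz br, solvablev br fullv, ~ nilpotentv br fullv &
      exists N Q : {vspace L},
        [/\ nilradical br N, isomorphic_algebras (@commutator F 4) (T4 F) br N,
            \dim Q = 2%N, (N + Q)%VS = fullv & (N :&: Q)%VS = 0%VS]].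

Section BracketFacts.
Variables (F : fieldType) (L : vectType F) (br : {bilinear L -> L -> L}).
Implicit Types U V W : {vspace L}.

Lemma memv_bracketv U V x y : x \in U -> y \in V -> br x y \in bracketv br U V.
Proof.
move=> xU yV.
rewrite (coord_vbasis xU) (coord_vbasis yV) linear_sumlz /=.
apply: memv_suml => i _; rewrite linearZl_LR linear_sumr /= memvZ //.
apply: memv_suml => j _; rewrite linearZr_LR memvZ //.
apply: memv_span; apply/allpairsP; exists ((vbasis U)`_i, (vbasis V)`_j).
by rewrite !mem_nth ?size_tuple.
Qed.

Lemma bracketv_subP U V W :
  (forall x y, x \in U -> y \in V -> br x y \in W) <->
  (bracketv br U V <= W)%VS.
Proof.
split=> [sW | sW x y xU yV].
  by apply/span_subvP => _ /allpairsP[[x y] /= [xU yV ->]];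
     apply: sW; apply: vbasis_mem.
exact/(subvP sW)/memv_bracketv.
Qed.

End BracketFacts.

Lemma memv_T4 (F : fieldType) (A : 'M[F]_4) :
  reflect (forall i j : 'I_4, (j <= i)%N -> A i j = 0) (A \in T4 F).
Proof.
apply: (iffP idP) => [/memv_sumP[B BP ->] i j leji | A0].
  rewrite summxE big1 // => -[k l] /= ltkl.
  have /vlineP[c ->] := BP (k, l) ltkl; rewrite !mxE /=.
  have [/= eik|_] := eqVneq i k; have [/= ejl|_] := eqVneq j l; rewrite ?mulr0 //.
  by rewrite -eik -ejl ltnNge leji in ltkl.
rewrite (matrix_sum_delta A) pair_bigA /=.
apply: memv_suml => -[i j] _ /=.
have [leji|ltij] := leqP j i; first by rewrite A0 // scale0r mem0v.
apply: memvZ; apply: (subvP (sumv_sup (i, j) _ (subvv _))) => //.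
exact: memv_line.
Qed.

(* Main.v *)
From HB Require Import structures.
Require Import Defs.
From mathcomp Require Import all_boot all_order all_algebra.
From mathcomp Require Import complex reals.
From mathcomp Require Import ring zify.

Set Implicit Arguments.
Unset Strict Implicit.
Unset Printing Implicit Defensive.

Import GRing.Theory Num.Theory.
Local Open Scope ring_scope.

(** Right multiplication by x is a derivation of T(4).  Comparing coefficients,
    every derivation of T(4) is triangular, with weights alpha, beta, gamma on
    N12, N23, N34 that are linear in x and vanish on T(4) and on [L,L].
    Solvability and the maximality of the nilradical N give [L,L] <= N, and an x
    of weights zero lies in N, since N + <x> is a nilpotent ideal.
    The elements [x,y] + [y,x] annihilate L from the right, hence are multiples
    of N14; as L is not Lie, [L,N14] = 0, which forces
    alpha + beta + gamma = 0.  So (alpha, beta) identifies L/N with F^2.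
    An x of weights 1, 3, -4 acts on T(4) with the distinct eigenvalues
    1, 3, -4, 4, -1, 0; its eigenvectors form a basis with the products of T(4).
    Choosing X1, X2 of weights (1,0,-1), (0,1,-1) with [Xi,x] in <N14>, right
    multiplication by Xi commutes with that by x on T(4), so it is diagonal too,
    and [Xi,n] + [n,Xi] and [Xi,Xj] are in the kernel of the action of x. *)

(** * Coordinates in a basis indexed like that of T(4) *)

Section Frames.
Variables (F : fieldType) (L : vectType F).
Implicit Types (e : nat -> nat -> L) (N : {vspace L}).

Definition t4frame e : 6.-tuple L :=
  [tuple e 1%N 2%N; e 2%N 3%N; e 3%N 4%N; e 1%N 3%N; e 2%N 4%N; e 1%N 4%N].

(** The coordinates are ordered along the lower central series of T(4): the first three vanish on
    [N,N], the first five on the centre. *)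
Definition t4comb e (a b c d f g : F) : L :=
  a *: e 1%N 2%N + b *: e 2%N 3%N + c *: e 3%N 4%N +
  d *: e 1%N 3%N + f *: e 2%N 4%N + g *: e 1%N 4%N.

Lemma sum_t4frame e (k : 'I_6 -> F) :
  \sum_i k i *: (t4frame e)`_i =
  t4comb e (k (inord 0)) (k (inord 1)) (k (inord 2))
           (k (inord 3)) (k (inord 4)) (k (inord 5)).
Proof.
rewrite !big_ord_recl big_ord0 addr0 /t4comb !addrA.
by do !congr (_ + _); congr (k _ *: _); apply: val_inj; rewrite /= inordK.
Qed.

Lemma t4combD e a b c d f g a' b' c' d' f' g' :
  t4comb e a b c d f g + t4comb e a' b' c' d' f' g' =
  t4comb e (a + a') (b + b') (c + c') (d + d') (f + f') (g + g').
Proof.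
rewrite /t4comb !scalerDl.
by do 5![rewrite addrACA; congr (_ + _)].
Qed.

Lemma t4combZ e k a b c d f g :
  k *: t4comb e a b c d f g =
  t4comb e (k * a) (k * b) (k * c) (k * d) (k * f) (k * g).
Proof. by rewrite /t4comb !scalerDr !scalerA. Qed.

Lemma t4combN e a b c d f g :
  - t4comb e a b c d f g = t4comb e (- a) (- b) (- c) (- d) (- f) (- g).
Proof. by rewrite -scaleN1r t4combZ !mulN1r. Qed.

Lemma t4combB e a b c d f g a' b' c' d' f' g' :
  t4comb e a b c d f g - t4comb e a' b' c' d' f' g' =
  t4comb e (a - a') (b - b') (c - c') (d - d') (f - f') (g - g').
Proof. by rewrite t4combN t4combD. Qed.

Lemma t4comb0 e : t4comb e 0 0 0 0 0 0 = 0.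
Proof. by rewrite /t4comb !scale0r !addr0. Qed.

Lemma t4comb12 e : e 1%N 2%N = t4comb e 1 0 0 0 0 0.
Proof. by rewrite /t4comb !scale0r scale1r ?(addr0, add0r). Qed.
Lemma t4comb23 e : e 2%N 3%N = t4comb e 0 1 0 0 0 0.
Proof. by rewrite /t4comb !scale0r scale1r ?(addr0, add0r). Qed.
Lemma t4comb34 e : e 3%N 4%N = t4comb e 0 0 1 0 0 0.
Proof. by rewrite /t4comb !scale0r scale1r ?(addr0, add0r). Qed.
Lemma t4comb13 e : e 1%N 3%N = t4comb e 0 0 0 1 0 0.
Proof. by rewrite /t4comb !scale0r scale1r ?(addr0, add0r). Qed.
Lemma t4comb24 e : e 2%N 4%N = t4comb e 0 0 0 0 1 0.
Proof. by rewrite /t4comb !scale0r scale1r ?(addr0, add0r). Qed.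
Lemma t4comb14 e : e 1%N 4%N = t4comb e 0 0 0 0 0 1.
Proof. by rewrite /t4comb !scale0r scale1r ?(addr0, add0r). Qed.

(** A multirule that puts frame vectors into coordinates, so that identities reduce to one [ring]
    goal per coefficient. *)
Definition t4combE e :=
  (t4comb12 e, t4comb23 e, t4comb34 e, t4comb13 e, t4comb24 e, t4comb14 e).

Section Basis.
Variables (N : {vspace L}) (e : nat -> nat -> L).
Hypothesis eN : basis_of N (t4frame e).

Lemma t4combP n : n \in N -> exists a b c d f g, n = t4comb e a b c d f g.
Proof.
by move=> /(coord_basis eN) ->; rewrite sum_t4frame; do 6![eexists].
Qed.

Lemma memv_t4comb a b c d f g : t4comb e a b c d f g \in N.
Proof.
have inN x : x \in t4frame e -> x \in N by exact: basis_mem eN.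
by rewrite /t4comb !memvD ?memvZ ?inN // !inE eqxx ?orbT.
Qed.

Lemma t4comb_eq0 a b c d f g : t4comb e a b c d f g = 0 ->
  [/\ a = 0, b = 0 & c = 0] /\ [/\ d = 0, f = 0 & g = 0].
Proof.
have /freeP freeE := basis_free eN.
pose k (i : 'I_6) := nth 0 [:: a; b; c; d; f; g] i.
move=> e0; have k0 : forall i, k i = 0.
  by apply: freeE; rewrite sum_t4frame /k !inordK.
by move: (k0 (inord 0)) (k0 (inord 1)) (k0 (inord 2)) (k0 (inord 3))
   (k0 (inord 4)) (k0 (inord 5)); rewrite /k !inordK.
Qed.

Lemma t4comb_inj a b c d f g a' b' c' d' f' g' :
  t4comb e a b c d f g = t4comb e a' b' c' d' f' g' ->
  [/\ a = a', b = b' & c = c'] /\ [/\ d = d', f = f' & g = g'].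
Proof.
move/(congr1 (fun v => v - t4comb e a' b' c' d' f' g')).
rewrite subrr t4combB => /t4comb_eq0[[]].
by do 3![move/subr0_eq=> ->]; case; do 3![move/subr0_eq=> ->].
Qed.

Lemma coord_t4comb i a b c d f g :
  coord (t4frame e) i (t4comb e a b c d f g) = [:: a; b; c; d; f; g]`_i.
Proof.
pose k (i : 'I_6) := nth 0 [:: a; b; c; d; f; g] i.
have := coord_sum_free k i (basis_free eN).
by rewrite sum_t4frame /k !inordK.
Qed.

Lemma t4frame_memv i j : (1 <= i < j)%N -> (j <= 4)%N -> e i j \in N.
Proof.
move: i j => [|[|[|[|i]]]] [|[|[|[|[|j]]]]] //= _ _;
by apply: (basis_mem eN); rewrite !inE eqxx ?orbT.
Qed.

End Basis.

Lemma t4comb_basis N e :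
    (forall n, n \in N -> exists a b c d f g, n = t4comb e a b c d f g) ->
    (forall x, x \in t4frame e -> x \in N) ->
    (forall a b c d f g, t4comb e a b c d f g = 0 ->
      [/\ a = 0, b = 0 & c = 0] /\ [/\ d = 0, f = 0 & g = 0]) ->
  basis_of N (t4frame e).
Proof.
move=> gen inN lin0; rewrite basisEfree; apply/and3P; split.
- apply/freeP => k; rewrite sum_t4frame => /lin0[[k0 k1 k2] [k3 k4 k5]] i.
  rewrite -(inord_val i).
  by case: i => -[|[|[|[|[|[|//]]]]]].
- exact/span_subvP.
rewrite size_tuple.
have sub : (N <= <<t4frame e>>)%VS.
  apply/subvP => n /gen[a [b [c [d [f [g ->]]]]]].
  by rewrite /t4comb !memvD ?memvZ ?memv_span // !inE eqxx ?orbT.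
by apply: leq_trans (dimvS sub) _; rewrite (leq_trans (dim_span _)) ?size_tuple.
Qed.

End Frames.

(** * The product of T(4) in coordinates *)

Section Products.
Variables (F : fieldType) (L : vectType F) (br : {bilinear L -> L -> L}).
Variable e : nat -> nat -> L.
Hypothesis Pe : T4_products br e.

Lemma br_t4comb a b c d f g a' b' c' d' f' g' :
  br (t4comb e a b c d f g) (t4comb e a' b' c' d' f' g') =
  t4comb e 0 0 0 (a * b' - b * a') (b * c' - c * b')
           (a * f' - f * a' + d * c' - c * d').
Proof.
rewrite {1 2}/t4comb !(linearDl, linearDr) /= !(linearZl_LR, linearZr_LR) /=.
rewrite !Pe //= !scale0r ?scale1r ?(subr0, sub0r, oppr0, scaler0, addr0, add0r).
rewrite /t4comb !scale0r !add0r !(scalerDl, scaleNr, scalerN) -!scalerA.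
(* The permutation collects the eight surviving terms by frame vector: N13, then N24, then N14. *)
by rewrite !addrA [LHS](+%R).[ACl 1*3*4*5*2*8*7*6]%AC.
Qed.
End Products.

(** Reduces the distinctness of eigenvalues to closed integer inequalities, decided by
    computation. *)
Lemma numeral_neq (F : numFieldType) (m n : int) :
  m != n -> m%:~R != n%:~R :> F.
Proof. by rewrite eqr_int. Qed.

(** * Right multiplications as derivations of T(4), and their weights *)

Section Weights.
Variables (F : numFieldType) (L : vectType F) (br : {bilinear L -> L -> L}).
Variables (N : {vspace L}) (e : nat -> nat -> L).
Hypotheses (brL : leibniz br) (idN : ideal br N).
Hypotheses (eN : basis_of N (t4frame e)) (eP : T4_products br e).

Lemma br_derivation x u v : br (br u v) x = br (br u x) v + br u (br v x).
Proof. by rewrite brL addrC subrK. Qed.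

Lemma br_memr x y : x \in N -> br x y \in N.
Proof. by move=> xN; have /andP[] := idN y xN. Qed.

Lemma br_meml x y : x \in N -> br y x \in N.
Proof. by move=> xN; have /andP[] := idN y xN. Qed.

(** A diagonal entry of the matrix of right multiplication by x on N. By [br_t4frame], the last
    three entries are sums of the first three. *)
Definition weight (i : 'I_6) (x : L) : F :=
  coord (t4frame e) i (br (t4frame e)`_i x).

Fact weight_is_linear i : linear_for *%R (weight i).
Proof. by move=> k x y; rewrite /weight !linearP. Qed.
HB.instance Definition _ i :=
  GRing.isLinear.Build F L F _ (weight i) (weight_is_linear i).

Definition weight12 := weight (@Ordinal 6 0 isT).
Definition weight23 := weight (@Ordinal 6 1 isT).
Definition weight34 := weight (@Ordinal 6 2 isT).

(** N12, N23, N34 generate T(4), so a derivation is determined by its values there. Differentiating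
    the zero products [N12,N13], [N23,N13], [N24,N34], [N24,N23] and [N12,N34] removes the
    off-diagonal coefficients among these generators. *)
Lemma br_t4frame x : exists p4 p5 p6 q4 q5 q6 r4 r5 r6,
  [/\ br (e 1%N 2%N) x = t4comb e (weight12 x) 0 0 p4 p5 p6,
      br (e 2%N 3%N) x = t4comb e 0 (weight23 x) 0 q4 q5 q6 &
      br (e 3%N 4%N) x = t4comb e 0 0 (weight34 x) r4 r5 r6] /\
  [/\ br (e 1%N 3%N) x = t4comb e 0 0 0 (weight12 x + weight23 x) 0 q5,
      br (e 2%N 4%N) x = t4comb e 0 0 0 0 (weight23 x + weight34 x) q4 &
      br (e 1%N 4%N) x =
        t4comb e 0 0 0 0 0 (weight12 x + weight23 x + weight34 x)].
Proof.
have inN i j : (1 <= i < j)%N -> (j <= 4)%N -> br (e i j) x \in N.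
  by move=> *; rewrite br_memr ?(t4frame_memv eN).
have [a1 [a2 [a3 [a4 [a5 [a6 Ea]]]]]] := t4combP eN (inN 1 2 isT isT)%N.
have [b1 [b2 [b3 [b4 [b5 [b6 Eb]]]]]] := t4combP eN (inN 2 3 isT isT)%N.
have [c1 [c2 [c3 [c4 [c5 [c6 Ec]]]]]] := t4combP eN (inN 3 4 isT isT)%N.
have -> : weight12 x = a1 by rewrite /weight12 /weight /= Ea (coord_t4comb eN).
have -> : weight23 x = b2 by rewrite /weight23 /weight /= Eb (coord_t4comb eN).
have -> : weight34 x = c3 by rewrite /weight34 /weight /= Ec (coord_t4comb eN).
have two0 : (2 : F) != 0 by rewrite pnatr_eq0.
have Ed : br (e 1%N 3%N) x = t4comb e 0 0 0 (a1 + b2) (- a3) b5.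
  have := br_derivation x (e 1 2)%N (e 2 3)%N.
  rewrite eP //= scale0r scale1r subr0 Ea Eb => ->.
  by rewrite !t4combE !br_t4comb // t4combD; congr t4comb; ring.
have Ef : br (e 2%N 4%N) x = t4comb e 0 0 0 (- c1) (b2 + c3) b4.
  have := br_derivation x (e 2 3)%N (e 3 4)%N.
  rewrite eP //= scale0r scale1r subr0 Eb Ec => ->.
  by rewrite !t4combE !br_t4comb // t4combD; congr t4comb; ring.
have prod0 i j k l : br (e i j) (e k l) = 0 ->
    br (br (e i j) x) (e k l) + br (e i j) (br (e k l) x) = 0.
  by move=> e0; rewrite -br_derivation e0 linear0l.
have table0 i j k l : (1 <= i < j)%N -> (j <= 4)%N -> (1 <= k < l)%N ->
    (l <= 4)%N -> (j != k) -> (i != l) -> br (e i j) (e k l) = 0.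
  by move=> ? ? ? ? /negPf jk /negPf il; rewrite eP // jk il !scale0r subr0.
(* Both summands of [prod0] contribute -a3 to the coefficient of N14, so -2 a3 = 0; the same happens
   for c1. *)
have a3_0 : a3 = 0.
  have := prod0 _ _ _ _ (table0 1 2 1 3 isT isT isT isT isT isT)%N.
  rewrite Ea Ed !t4combE !br_t4comb // t4combD => /(t4comb_eq0 eN)[_ [_ _ E]].
  apply/eqP; rewrite -(mulrI_eq0 _ (mulfI two0)) -oppr_eq0 -E.
  by apply/eqP; ring.
have b3_0 : b3 = 0.
  have := prod0 _ _ _ _ (table0 2 3 1 3 isT isT isT isT isT isT)%N.
  rewrite Eb Ed !t4combE !br_t4comb // t4combD => /(t4comb_eq0 eN)[_ [_ _ E]].
  by apply/eqP; rewrite -oppr_eq0 -E; apply/eqP; ring.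
have c1_0 : c1 = 0.
  have := prod0 _ _ _ _ (table0 2 4 3 4 isT isT isT isT isT isT)%N.
  rewrite Ec Ef !t4combE !br_t4comb // t4combD => /(t4comb_eq0 eN)[_ [_ _ E]].
  apply/eqP; rewrite -(mulrI_eq0 _ (mulfI two0)) -oppr_eq0 -E.
  by apply/eqP; ring.
have b1_0 : b1 = 0.
  have := prod0 _ _ _ _ (table0 2 4 2 3 isT isT isT isT isT isT)%N.
  rewrite Eb Ef !t4combE !br_t4comb // t4combD => /(t4comb_eq0 eN)[_ [_ _ E]].
  by apply/eqP; rewrite -oppr_eq0 -E; apply/eqP; ring.
have [a2_0 c2_0] : a2 = 0 /\ c2 = 0.
  have := prod0 _ _ _ _ (table0 1 2 3 4 isT isT isT isT isT isT)%N.
  rewrite Ea Ec !t4combE !br_t4comb // t4combD => /(t4comb_eq0 eN)[_ [E E' _]].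
  by split; [rewrite -E' | rewrite -E]; ring.
have Eg : br (e 1%N 4%N) x = t4comb e 0 0 0 0 0 (a1 + b2 + c3).
  have := br_derivation x (e 1 2)%N (e 2 4)%N.
  rewrite eP //= scale0r scale1r subr0 Ea Ef => ->.
  rewrite !t4combE !br_t4comb // t4combD a3_0 c1_0.
  by congr t4comb; ring.
exists a4, a5, a6, b4, b5, b6, c4, c5, c6.
rewrite Ea Eb Ec Ed Ef Eg a2_0 a3_0 b1_0 b3_0 c1_0 c2_0.
by split; split; rewrite ?oppr0.
Qed.

Lemma br_t4comb_weight x a b c d f g : exists d' f' g',
  br (t4comb e a b c d f g) x =
  t4comb e (a * weight12 x) (b * weight23 x) (c * weight34 x) d' f' g'.
Proof.
have [p4 [p5 [p6 [q4 [q5 [q6 [r4 [r5 [r6 [[Ea Eb Ec] [Ed Ef Eg]]]]]]]]]]] :=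
  br_t4frame x.
rewrite {1}/t4comb !linearDl /= !linearZl_LR /= Ea Eb Ec Ed Ef Eg.
rewrite !t4combZ !t4combD; do 3![eexists].
by congr t4comb; first [ring | reflexivity].
Qed.

Lemma br_t4comb_weight2 x d f g : exists g',
  br (t4comb e 0 0 0 d f g) x =
  t4comb e 0 0 0 (d * (weight12 x + weight23 x)) (f * (weight23 x + weight34 x))
    g'.
Proof.
have [p4 [p5 [p6 [q4 [q5 [q6 [r4 [r5 [r6 [_ [Ed Ef Eg]]]]]]]]]]] :=
  br_t4frame x.
rewrite {1}/t4comb !linearDl /= !linearZl_LR /= Ed Ef Eg !scale0r !add0r.
rewrite !t4combZ !t4combD; eexists.
by congr t4comb; first [ring | reflexivity].
Qed.

(** By the Leibniz identity, right multiplication by [x,y] is a commutator of two triangular maps,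
    whose diagonal is zero. *)
Lemma weight_br x y :
  [/\ weight12 (br x y) = 0, weight23 (br x y) = 0 & weight34 (br x y) = 0].
Proof.
have [p4 [p5 [p6 [q4 [q5 [q6 [r4 [r5 [r6 [[Ea Eb Ec] _]]]]]]]]]] :=
  br_t4frame x.
have [s4 [s5 [s6 [t4 [t5 [t6 [u4 [u5 [u6 [[Ga Gb Gc] _]]]]]]]]]] :=
  br_t4frame y.
split; rewrite [LHS]/weight /= brL ?Ea ?Eb ?Ec ?Ga ?Gb ?Gc;
  set u := br (t4comb _ _ _ _ _ _ _) _; set v := br (t4comb _ _ _ _ _ _ _) _;
  have [? [? [? ->]]] : exists d f g, u = _ := br_t4comb_weight _ _ _ _ _ _ _;
  have [? [? [? ->]]] : exists d f g, v = _ := br_t4comb_weight _ _ _ _ _ _ _;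
  rewrite t4combB (coord_t4comb eN) /=; ring.
Qed.

(** Products inside T(4) have no component on the generators. *)
Lemma weight_N n : n \in N ->
  [/\ weight12 n = 0, weight23 n = 0 & weight34 n = 0].
Proof.
case/(t4combP eN) => [a [b [c [d [f [g ->]]]]]].
by split; rewrite [LHS]/weight /= t4combE br_t4comb // (coord_t4comb eN).
Qed.

(** The centre of T(4) is the line of N14; testing against the three generators suffices. *)
Lemma right_annihilator_N n : n \in N -> (forall y, y \in N -> br y n = 0) ->
  exists g, n = g *: e 1%N 4%N.
Proof.
case/(t4combP eN) => [a [b [c [d [f [g ->]]]]]] ann.
have annE i j (ij : (1 <= i < j)%N) j4 := ann _ (t4frame_memv eN ij j4).
have := (annE 1 2 isT isT)%N.
rewrite t4combE br_t4comb // => /(t4comb_eq0 eN)[_ [E1 _ E2]].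
have := (annE 2 3 isT isT)%N.
rewrite t4combE br_t4comb // => /(t4comb_eq0 eN)[_ [E3 E4 _]].
have := (annE 3 4 isT isT)%N.
rewrite t4combE br_t4comb // => /(t4comb_eq0 eN)[_ [_ _ E5]].
exists g; rewrite t4combE t4combZ mulr0 mulr1; congr t4comb.
- by rewrite -[RHS]oppr0 -E3; ring.
- by rewrite -[RHS]E1; ring.
- by rewrite -[RHS]E4; ring.
- by rewrite -[RHS]oppr0 -E5; ring.
- by rewrite -[RHS]E2; ring.
Qed.

(** This is the derived algebra [N,N]. *)
Let N2 : {vspace L} := (<[e 1%N 3%N]> + <[e 2%N 4%N]> + <[e 1%N 4%N]>)%VS.

Lemma memv_N2P n :
  reflect (exists d f g, n = t4comb e 0 0 0 d f g) (n \in N2).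
Proof.
apply: (iffP memv_addP) => [[u /memv_addP[_ /vlineP[d ->] [_ /vlineP[f ->] ->]]
  [_ /vlineP[g ->] ->]] | [d [f [g ->]]]].
  by exists d, f, g; rewrite /t4comb !scale0r !add0r.
exists (d *: e 1%N 3%N + f *: e 2%N 4%N).
  by rewrite memv_add ?memvZ ?memv_line.
exists (g *: e 1%N 4%N); first by rewrite memvZ ?memv_line.
by rewrite /t4comb !scale0r !add0r.
Qed.

Definition null_weights x :=
  [/\ weight12 x = 0, weight23 x = 0 & weight34 x = 0].

(** Turns vanishing of the weights into membership in a subspace, so that it can be checked on the
    summands of a sum and on products spanning a bracket. *)
Lemma memv_null_weights :
  exists K : {vspace L}, forall x, x \in K <-> null_weights x.
Proof.
pose k i : {vspace L} := lker (linfun (weight i : L -> F^o)).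
have kE i x : (x \in k i) = (weight i x == 0) by rewrite memv_ker lfunE.
exists (k (@Ordinal 6 0 isT) :&: k (@Ordinal 6 1 isT)
        :&: k (@Ordinal 6 2 isT))%VS.
move=> x; rewrite !memv_cap !kE -andbA.
by split=> [/and3P[/eqP ? /eqP ? /eqP ?] | [/eqP ? /eqP ? /eqP ?]];
  [split | apply/and3P].
Qed.

(** With zero diagonal, right multiplication moves each layer of the chain N, [N,N], <N14>, 0 into
    the next. One bracket enters N and three more reach 0, whence the index 4. *)
Lemma null_weights_nilpotent (I : {vspace L}) :
    (forall x y, x \in I -> y \in I -> br x y \in N) ->
    (forall x, x \in I -> null_weights x) ->
  nilpotentv br I.
Proof.
move=> brI nullI; exists 4%N.
have L1 : (lower_central br I 1 <= N)%VS by apply/bracketv_subP.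
have L2 : (lower_central br I 2 <= N2)%VS.
  apply/bracketv_subP => _ y
    /(subvP L1)/(t4combP eN)[a [b [c [d [f [g ->]]]]]].
  move=> /nullI[y1 y2 y3]; apply/memv_N2P.
  have [d' [f' [g' ->]]] := br_t4comb_weight y a b c d f g.
  by rewrite y1 y2 y3 !mulr0; exists d', f', g'.
have L3 : (lower_central br I 3 <= <[e 1%N 4%N]>)%VS.
  apply/bracketv_subP => _ y /(subvP L2)/memv_N2P [d [f [g ->]]].
  move=> /nullI[y1 y2 y3]; have [g' ->] := br_t4comb_weight2 y d f g.
  rewrite y1 y2 y3 !addr0 !mulr0 /t4comb !scale0r !add0r.
  by rewrite memvZ ?memv_line.
apply/eqP; rewrite -subv0; apply/bracketv_subP => _ y /(subvP L3)/vlineP[k ->].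
move=> /nullI[y1 y2 y3].
have [_ [_ [_ [_ [_ [_ [_ [_ [_ [_ [_ _ Eg]]]]]]]]]]] := br_t4frame y.
by rewrite linearZl_LR /= Eg y1 y2 y3 !addr0 t4comb0 scaler0 mem0v.
Qed.

(** * Solvability and maximality of the nilradical *)

Section Solvable.
Hypothesis solvL : solvablev br fullv.
Hypothesis maxN : forall I : {vspace L},
  ideal br I -> nilpotentv br I -> (N <= I)%VS -> I = N.
Hypothesis dimL : \dim {: L} = 8%N.

(** Modulo N, a subspace contained in its own bracket lies in every term of the derived series, and
    the last term is zero. *)
Lemma subv_N_bracketv (U : {vspace L}) :
  (U <= N + bracketv br U U)%VS -> (U <= N)%VS.
Proof.
move=> subU; have [k Dk] := solvL.
suff : (U <= N + derived_series br fullv k)%VS by rewrite Dk addv0.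
elim: k {Dk} => [|k IHk]; first by rewrite (subv_trans (subvf _)) ?addvSr.
apply: subv_trans subU _; rewrite subv_add addvSl /=.
apply/bracketv_subP => x y /(subvP IHk)/memv_addP[n nN [u uD ->]].
move=> /(subvP IHk)/memv_addP[m mN [v vD ->]].
rewrite linearDl /= [br u _]linearDr /= addrA memv_add //.
  by apply: memvD; [exact: br_memr | exact: br_meml].
exact: memv_bracketv.
Qed.

(** The ideal P = N + [L,L] has zero weights. If [P,P] lies in N, then P is nilpotent and maximality
    gives P = N; the other case is excluded by counting dimensions between 6 and 8. *)
Lemma br_in_N x y : br x y \in N.
Proof.
suff: (bracketv br fullv fullv <= N)%VS.
  by move/bracketv_subP; apply; rewrite memvf.
set D := bracketv br fullv fullv; set P := (N + D)%VS.
have brP u v : br u v \in P.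
  by rewrite (subvP (addvSr _ _)) ?memv_bracketv ?memvf.
have idP (I : {vspace L}) : (P <= I)%VS -> ideal br I.
  by move=> PI u v _; rewrite !(subvP PI).
have nullP u : u \in P -> null_weights u.
  have [K KP] := memv_null_weights.
  suff /subvP PK : (P <= K)%VS by move/PK/KP.
  rewrite subv_add; apply/andP; split; first by apply/subvP=> n /weight_N/KP.
  by apply/bracketv_subP => ? ? _ _; apply/KP/weight_br.
have NP : (N <= P)%VS by rewrite addvSl.
have eqP_N : (forall u v, u \in P -> v \in P -> br u v \in N) -> P = N.
  move=> brPN; apply: maxN => //; first exact: idP.
  exact: null_weights_nilpotent.
suff -> : N = P by rewrite addvSr.
have dimN := size_basis eN.
have nfull : ~~ (fullv <= P)%VS.
  apply/negP => fullP; have /dimvS := subv_N_bracketv fullP.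
  by rewrite dimL dimN.
set W := (N + bracketv br P P)%VS.
have WP : (W <= P)%VS.
  by rewrite subv_add NP; apply/bracketv_subP => u v uP _; rewrite brP.
have [WN|WN] := boolP (W <= N)%VS.
  rewrite eqP_N // => u v uP vP; apply/(subvP WN)/(subvP (addvSr _ _)).
  exact: memv_bracketv.
(* Otherwise dim N = 6 < dim W <= dim P <= 7, so P = N + [P, P], which
   solvability excludes. *)
have dP : (\dim P <= 7)%N.
  rewrite -ltnS -dimL ltnNge; apply: contra nfull => dP.
  by have /eqP-> : P == fullv by rewrite eqEdim subvf.
have dW : (6 < \dim W)%N.
  rewrite -dimN ltnNge; apply: contra WN => dW.
  by have /eqP<- : N == W by rewrite eqEdim addvSl.
have PW : (P <= W)%VS.
  by have /eqP-> : W == P by rewrite eqEdim WP (leq_trans dP).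
by apply/eqP; rewrite eqEsubv NP subv_N_bracketv.
Qed.

Lemma null_weights_memv x : null_weights x -> x \in N.
Proof.
move=> null_x; have [K KP] := memv_null_weights.
suff <- : (N + <[x]>)%VS = N by rewrite (subvP (addvSr _ _)) ?memv_line.
have IK : (N + <[x]> <= K)%VS.
  rewrite subv_add -memvE; apply/andP; split; last exact/KP.
  by apply/subvP => n /weight_N/KP.
apply: maxN; last by rewrite addvSl.
- by move=> u v _; rewrite !(subvP (addvSl _ _)) ?br_in_N.
apply: null_weights_nilpotent => [u v _ _|u /(subvP IK)/KP //].
exact: br_in_N.
Qed.

(** The Leibniz identity makes [z,[x,y]] antisymmetric in x and y, so right multiplication by [x,y]
    + [y,x] is zero. *)
Lemma br_sym x y : exists k, br x y + br y x = k *: e 1%N 4%N.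
Proof.
apply: right_annihilator_N => [|z _]; first by rewrite memvD ?br_in_N.
rewrite linearDr /= (brL z x y) (brL z y x).
by rewrite addrA subrK subrr.
Qed.

(** * Consequences of not being a Lie algebra *)

Section NonLie.
Hypothesis nonLie : ~ lie br.

(** Each [x,y] + [y,x] is a multiple of N14 that z annihilates from the left. If [z,N14] were
    nonzero, all these multiples would vanish, the bracket would be antisymmetric and L would be
    Lie. *)
Lemma br_e14r z : br z (e 1%N 4%N) = 0.
Proof.
apply/eqP/negPn/negP => zg_neq0; apply: nonLie.
have ann x y : br z (br x y + br y x) = 0.
  rewrite linearDr /= (brL z x y) (brL z y x).
  by rewrite addrA subrK subrr.
have anti x y : br x y = - br y x.
  apply/eqP; rewrite -addr_eq0; apply/eqP.
  have := ann x y; have [k ->] := br_sym x y.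
  rewrite linearZr_LR /= => /eqP; rewrite scaler_eq0 (negPf zg_neq0) orbF.
  by move/eqP=> ->; rewrite scale0r.
split=> [x | x y z'].
  have: 2%:R *: br x x = 0 by rewrite scaler_nat mulr2n {1}anti addNr.
  by move/eqP; rewrite scaler_eq0 pnatr_eq0 => /eqP.
rewrite (brL x y z') (anti y) (anti z' (br x y)) (anti z' x) linearNl /=.
by rewrite opprK addrNK subrr.
Qed.

(** The sum is the weight of x on N14 = [N12,N24]. Left and right multiplication by x are opposite
    modulo N14, which is central in N, so expanding [x,[N12,N24]] gives minus this weight times N14;
    and [x,N14] = 0. *)
Lemma weight_sum x : weight12 x + weight23 x + weight34 x = 0.
Proof.
have [p4 [p5 [p6 [q4 [q5 [q6 [r4 [r5 [r6 [[Ea _ _] [_ Ef Eg]]]]]]]]]]] :=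
  br_t4frame x.
have brx y : exists k, br x y = k *: e 1%N 4%N - br y x.
  by have [k E] := br_sym x y; exists k; rewrite -E addrK.
have := brL x (e 1 2)%N (e 2 4)%N.
rewrite (eP (i := 1) (j := 2) (k := 2) (l := 4)) //= scale0r scale1r subr0.
rewrite br_e14r.
have [k ->] := brx (e 1 2)%N; have [l ->] := brx (e 2 4)%N; rewrite Ea Ef.
rewrite !t4combE !t4combZ !t4combB !br_t4comb // t4combB -(t4comb0 e).
case/(t4comb_inj eN) => _ [_ _ E].
by rewrite -[RHS]oppr0 E; ring.
Qed.
(** The first two weights define a map to F^2 with kernel exactly N, of codimension 8 - 6 = 2; hence
    it is onto. *)
Lemma exists_weights a b : exists x, weight12 x = a /\ weight23 x = b.
Proof.
pose w x : 'rV[F]_2 := \row_i (if i == 0 then weight12 x else weight23 x).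
have wL : linear w.
  by move=> k x y; apply/rowP => i; rewrite !mxE;
     case: ifP => _; exact: weight_is_linear.
pose wlin := GRing.isLinear.Build F L 'rV[F]_2 _ w wL.
pose f : 'Hom(L, 'rV[F]_2) := linfun (HB.pack w wlin : {linear L -> 'rV[F]_2}).
have fE x : f x = w x by rewrite lfunE.
have kerf : lker f = N.
  apply/eqP; rewrite eqEsubv; apply/andP; split; apply/subvP => x.
    rewrite memv_ker fE => /eqP/rowP wx; apply: null_weights_memv.
    have x1 := wx 0; have x2 := wx 1; rewrite !mxE /= in x1 x2.
    have := weight_sum x; rewrite x1 x2 !add0r => x3.
    by split.
  case/weight_N=> x1 x2 _; rewrite memv_ker fE; apply/eqP/rowP => i.
  by rewrite !mxE x1 x2; case: ifP.
have := limg_ker_dim f fullv; rewrite capfv kerf dimL (size_basis eN) => dimf.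
have imf : limg f = fullv.
  by apply/eqP; rewrite eqEdim subvf dimvf /dim /=; lia.
have : \row_i (if i == 0 then a else b) \in limg f by rewrite imf memvf.
case/memv_imgP => x _ /rowP fx; exists x.
have := fx 0; have := fx 1; rewrite !fE !mxE /=.
by [].
Qed.

End NonLie.
End Solvable.

(** * A frame of eigenvectors for an element of weights 1, 3, -4 *)

Section Diagonalization.
Variable x : L.
Hypotheses (x12 : weight12 x = 1) (x23 : weight23 x = 3).
Hypothesis x34 : weight34 x = -4.

(** On [N,N], right multiplication by x has the eigenvalues 4, -1, 0. As w is none of them, an
    eigenvector modulo [N,N] can be corrected to a true one. *)
Lemma eigenvector_lift v (w d f g : F) : w != 4 -> w != -1 -> w != 0 ->
    br v x = w *: v + t4comb e 0 0 0 d f g ->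
  exists p q r, let u := v + t4comb e 0 0 0 p q r in br u x = w *: u.
Proof.
move=> w4 w1 w0 vx.
(* These solve d + 4p = wp and f - q = wq. The correction spills g1 into N14, where x acts by 0, so
   the last coefficient r solves g + g1 = wr. *)
pose p := d / (w - 4); pose q := f / (w + 1).
have [g1 ux] := br_t4comb_weight2 x p q 0.
exists p, q, ((g + g1) / w).
have [_ [_ [_ [_ [_ [_ [_ [_ [_ [_ [_ _ Eg]]]]]]]]]]] := br_t4frame x.
have -> : t4comb e 0 0 0 p q ((g + g1) / w) =
          t4comb e 0 0 0 p q 0 + ((g + g1) / w) *: e 1%N 4%N.
  by rewrite t4combE t4combZ t4combD; congr t4comb; ring.
rewrite /= 2!linearDl /= linearZl_LR /= vx ux Eg x12 x23 x34.
rewrite [w *: (v + _)]scalerDr -addrA; congr (_ + _).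
rewrite t4combE !t4combZ !t4combD !t4combZ.
have w4' : w - 4 != 0 by rewrite subr_eq0.
have w1' : w + 1 != 0 by rewrite addr_eq0.
by congr t4comb; rewrite /p /q; field; rewrite ?w0.
Qed.

Lemma exists_eigenframe : exists e' : nat -> nat -> L,
  [/\ basis_of N (t4frame e'), T4_products br e' &
    [/\ br (e' 1 2)%N x = e' 1%N 2%N, br (e' 2 3)%N x = 3 *: e' 2%N 3%N &
      br (e' 3 4)%N x = -4 *: e' 3%N 4%N]].
Proof.
have neq (m n : int) := @numeral_neq F m n.
have [p4 [p5 [p6 [q4 [q5 [q6 [r4 [r5 [r6 [[Ea Eb Ec] [_ _ Eg]]]]]]]]]]] :=
  br_t4frame x.
rewrite x12 x23 x34 in Ea Eb Ec Eg.
have [] := @eigenvector_lift (e 1 2)%N 1 p4 p5 p6.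
- exact: neq 1 4 isT.
- exact: neq 1 (-1) isT.
- exact: neq 1 0 isT.
- by rewrite Ea t4combE t4combZ t4combD; congr t4comb; ring.
move=> a4 [a5 [a6 /= Ga]].
have [] := @eigenvector_lift (e 2 3)%N 3 q4 q5 q6.
- exact: neq 3 4 isT.
- exact: neq 3 (-1) isT.
- exact: neq 3 0 isT.
- by rewrite Eb t4combE t4combZ t4combD; congr t4comb; ring.
move=> b4 [b5 [b6 /= Gb]].
have [] := @eigenvector_lift (e 3 4)%N (-4) r4 r5 r6.
- exact: neq (-4) 4 isT.
- exact: neq (-4) (-1) isT.
- exact: neq (-4) 0 isT.
- by rewrite Ec t4combE t4combZ t4combD; congr t4comb; ring.
move=> c4 [c5 [c6 /= Gc]].
rewrite !t4combE !t4combD !(addr0, add0r) in Ga Gb Gc.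
(* The product of the first and third eigenvectors is a multiple of e 1 4, of
   eigenvalue 0, and would have eigenvalue 1 - 4. *)
have a4c5 : a4 + c5 = 0.
  have := br_derivation x (t4comb e 1 0 0 a4 a5 a6) (t4comb e 0 0 1 c4 c5 c6).
  rewrite Ga Gc linearZr_LR /= linearZl_LR /= -scalerDl.
  have -> : br (t4comb e 1 0 0 a4 a5 a6) (t4comb e 0 0 1 c4 c5 c6) =
            (a4 + c5) *: e 1%N 4%N.
    by rewrite br_t4comb // t4combE t4combZ; congr t4comb; ring.
  rewrite linearZl_LR /= Eg t4combE !t4combZ => /(t4comb_inj eN)[_ [_ _ E]].
  have: 3%:R * (a4 + c5) = 0.
    by move/eqP: E; rewrite -subr_eq0 => /eqP <-; ring.
  by move/eqP; rewrite mulf_eq0 pnatr_eq0 => /eqP.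
have c5E : c5 = - a4 by apply/eqP; rewrite -addr_eq0 addrC a4c5.
(* The vectors at 13 and 24 are the products of consecutive eigenvectors, whence their N14
   coefficients b5 and b4. *)
pose e' (i j : nat) := match i, j with
  | 1, 2 => t4comb e 1 0 0 a4 a5 a6
  | 2, 3 => t4comb e 0 1 0 b4 b5 b6
  | 3, 4 => t4comb e 0 0 1 c4 c5 c6
  | 1, 3 => t4comb e 0 0 0 1 0 b5
  | 2, 4 => t4comb e 0 0 0 0 1 b4
  | _, _ => e 1%N 4%N
  end%N.
have e'E a b c d f g : t4comb e' a b c d f g =
    t4comb e a b c (a * a4 + b * b4 + c * c4 + d) (a * a5 + b * b5 + c * c5 + f)
      (a * a6 + b * b6 + c * c6 + d * b5 + f * b4 + g).
  rewrite [LHS]/t4comb /= [e 1%N 4%N]t4combE !t4combZ !t4combD.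
  by congr t4comb; ring.
exists e'; split; last 1 first.
- by split=> //=; rewrite Ga scale1r.
- apply: t4comb_basis.
  + move=> n /(t4combP eN)[a [b [c [d [f [g ->]]]]]].
    (* The change of frame [e'E] is unitriangular and is inverted by back substitution. *)
    pose d1 := d - (a * a4 + b * b4 + c * c4).
    pose f1 := f - (a * a5 + b * b5 + c * c5).
    pose g1 := g - (a * a6 + b * b6 + c * c6 + d1 * b5 + f1 * b4).
    by exists a, b, c, d1, f1, g1; rewrite e'E; congr t4comb;
       rewrite /g1 /d1 /f1; ring.
  + move=> y; rewrite !inE /= [e 1%N 4%N]t4combE.
    by do 5![case/orP=> [/eqP->|]; first exact: memv_t4comb] => /eqP->;
       exact: memv_t4comb.
  + move=> a b c d f g; rewrite e'E => /(t4comb_eq0 eN)[[-> -> ->]].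
    by rewrite !mul0r !add0r => -[-> ->]; rewrite !mul0r !add0r => ->.
move=> i j k l.
move: i j => [|[|[|[|i]]]] [|[|[|[|[|j]]]]] // _ _;
move: k l => [|[|[|[|k]]]] [|[|[|[|[|l]]]]] // _ _;
by rewrite /= ?[e 1%N 4%N]t4combE br_t4comb // !t4combZ t4combB ?c5E;
   congr t4comb; rewrite /=; ring.
Qed.
End Diagonalization.
End Weights.

(** * Elements whose action commutes with that of x *)

Section Eigenframe.
Variables (F : numFieldType) (L : vectType F) (br : {bilinear L -> L -> L}).
Variables (N : {vspace L}) (e : nat -> nat -> L) (x : L).
Hypotheses (brL : leibniz br) (idN : ideal br N).
Hypotheses (eN : basis_of N (t4frame e)) (eP : T4_products br e).
Hypotheses (brN : forall y z, br y z \in N).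
Hypotheses (br_symE : forall y z, exists k, br y z + br z y = k *: e 1%N 4%N).
Hypotheses (br_e14 : forall y, br y (e 1%N 4%N) = 0).
Hypotheses (w_sum : forall y,
  weight12 br e y + weight23 br e y + weight34 br e y = 0).
Hypotheses (x12 : br (e 1%N 2%N) x = e 1%N 2%N).
Hypotheses (x23 : br (e 2%N 3%N) x = 3 *: e 2%N 3%N).
Hypotheses (x34 : br (e 3%N 4%N) x = -4 *: e 3%N 4%N).

Let der := br_derivation brL.

Lemma br_e14l y : br (e 1%N 4%N) y = 0.
Proof.
have [_ [_ [_ [_ [_ [_ [_ [_ [_ [_ [_ _ ->]]]]]]]]]]] :=
  br_t4frame brL idN eN eP y.
by rewrite w_sum t4comb0.
Qed.

Lemma br_t4comb_eigen a b c d f g : br (t4comb e a b c d f g) x =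
  t4comb e a (3 * b) (-4 * c) (4 * d) (- f) 0.
Proof.
have x13 : br (e 1%N 3%N) x = 4 *: e 1%N 3%N.
  have := der x (e 1 2)%N (e 2 3)%N.
  rewrite eP //= scale0r scale1r subr0 x12 x23 => ->.
  rewrite !t4combE !t4combZ !br_t4comb // t4combD; congr t4comb; ring.
have x24 : br (e 2%N 4%N) x = -1 *: e 2%N 4%N.
  have := der x (e 2 3)%N (e 3 4)%N.
  rewrite eP //= scale0r scale1r subr0 x23 x34 => ->.
  rewrite !t4combE !t4combZ !br_t4comb // t4combD; congr t4comb; ring.
rewrite {1}/t4comb !linearDl /= !linearZl_LR /= x12 x23 x34 x13 x24 br_e14l.
rewrite scaler0 addr0 !t4combE !t4combZ !t4combD; congr t4comb; ring.
Qed.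

Lemma eigenvector_t4comb (w a b c d f g : F) : w != 4 -> w != -1 -> w != 0 ->
    br (t4comb e a b c d f g) x = w *: t4comb e a b c d f g ->
  [/\ d = 0, f = 0 & g = 0].
Proof.
move=> w4 w1 w0; rewrite br_t4comb_eigen t4combZ.
case/(t4comb_inj eN) => _ [/eqP Ed /eqP Ef /eqP Eg]; split; apply/eqP.
- move: Ed; rewrite -subr_eq0 -mulrBl mulf_eq0 subr_eq0 eq_sym.
  by rewrite (negPf w4).
- move: Ef; rewrite -mulN1r -subr_eq0 -mulrBl mulf_eq0 subr_eq0 eq_sym.
  by rewrite (negPf w1).
- by move: Eg; rewrite eq_sym mulf_eq0 (negPf w0).
Qed.

(** As [n,N14] = 0 for all n, this condition makes right multiplications by x and y commute. *)
Definition adapted y := exists k, br y x = k *: e 1%N 4%N.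

(** On N, x acts diagonally with kernel the line of N14, so dividing the coefficients of [y,x] by
    minus the eigenvalues 1, 3, -4, 4, -1 gives the correction u. *)
Lemma exists_adapted y : exists2 u, u \in N & adapted (y + u).
Proof.
have [a [b [c [d [f [g yx]]]]]] := t4combP eN (brN y x).
exists (t4comb e (- a) (- b / 3) (c / 4) (- d / 4) f 0).
  exact: (memv_t4comb eN).
exists g; rewrite linearDl /= yx br_t4comb_eigen t4combE t4combZ t4combD.
by congr t4comb; field.
Qed.

Lemma adapted_lin k l y z : adapted y -> adapted z ->
  adapted (k *: y + l *: z).
Proof.
case=> m yx [n zx]; exists (k * m + l * n).
by rewrite linearDl /= !linearZl_LR /= yx zx !scalerA scalerDl.
Qed.

Lemma adaptedx : adapted x.
Proof.
have [k E] := br_symE x x; exists (k / 2).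
have two0 : (2 : F) != 0 by rewrite pnatr_eq0.
apply: (scalerI two0); rewrite scalerA mulrCA mulfV // mulr1 -E.
by rewrite scaler_nat mulr2n.
Qed.

Lemma adapted_br y z : adapted y -> adapted z ->
  exists k, br y z = k *: e 1%N 4%N.
Proof.
case=> k yx [l zx].
have yz0 : br (br y z) x = 0.
  rewrite der yx zx linearZl_LR linearZr_LR /= br_e14 br_e14l.
  by rewrite !scaler0 addr0.
have [a [b [c [d [f [g E]]]]]] := t4combP eN (brN y z).
exists g; move: yz0; rewrite E br_t4comb_eigen.
case/(t4comb_eq0 eN) => -[-> /eqP b0 /eqP c0] [/eqP d0 /eqP f0 _].
move: b0 c0 d0 f0; rewrite oppr_eq0 !mulf_eq0 oppr_eq0 !pnatr_eq0 /=.
move=> /eqP-> /eqP-> /eqP-> /eqP->.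
by rewrite t4combE t4combZ !mulr0 mulr1.
Qed.

Section Adapted.
Variable y : L.
Hypothesis yx : adapted y.

Lemma adapted_skew n (w : F) : w != 0 -> br n x = w *: n ->
  br y n = - br n y.
Proof.
case: yx => k yxE w0 nx; have [l E] := br_symE y n.
have nz : br (e 1%N 4%N) n = 0 by exact: br_e14l.
have : br (br y n + br n y) x = w *: (br y n + br n y).
  rewrite linearDl /= (der x y n) (der x n y) yxE nx [br y (w *: n)]linearZr_LR
    [br (w *: n) y]linearZl_LR [br (k *: _) n]linearZl_LR
    [br n (k *: _)]linearZr_LR /=.
  by rewrite nz br_e14 !scaler0 add0r addr0 scalerDr.
rewrite E linearZl_LR /= br_e14l scaler0 -E => /esym/eqP.
by rewrite scaler_eq0 (negPf w0) /= addr_eq0 => /eqP.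
Qed.

Lemma adapted_eigen n (w : F) : br n x = w *: n -> br (br n y) x = w *: br n y.
Proof.
case: yx => k yxE nx.
by rewrite der nx yxE linearZl_LR linearZr_LR /= br_e14 scaler0 addr0.
Qed.

Lemma adapted_t4frame :
  [/\ br (e 1%N 2%N) y = weight12 br e y *: e 1%N 2%N,
      br (e 2%N 3%N) y = weight23 br e y *: e 2%N 3%N &
      br (e 3%N 4%N) y = weight34 br e y *: e 3%N 4%N] /\
  (br (e 1%N 3%N) y = (weight12 br e y + weight23 br e y) *: e 1%N 3%N /\
   br (e 2%N 4%N) y = (weight23 br e y + weight34 br e y) *: e 2%N 4%N).
Proof.
have := @adapted_eigen (e 1 2)%N 1; rewrite !scale1r => /(_ x12).
have := adapted_eigen x23; have := adapted_eigen x34.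
have [p4 [p5 [p6 [q4 [q5 [q6 [r4 [r5 [r6 [[Ea Eb Ec] [Ed Ef _]]]]]]]]]]] :=
  br_t4frame brL idN eN eP y.
rewrite Ea Eb Ec Ed Ef => Fc Fb; rewrite -[t4comb _ _ _ _ p4 _ _ in RHS]scale1r.
have neq (m n : int) := @numeral_neq F m n.
case/(eigenvector_t4comb (neq 1 4 isT) (neq 1 (-1) isT) (neq 1 0 isT)).
move=> -> -> ->.
case: (eigenvector_t4comb (neq 3 4 isT) (neq 3 (-1) isT) (neq 3 0 isT) Fb).
move=> -> -> ->.
case: (eigenvector_t4comb (neq (-4) 4 isT) (neq (-4) (-1) isT)
         (neq (-4) 0 isT) Fc).
move=> -> -> ->.
by rewrite !t4combE !t4combZ; split; [split|split]; congr t4comb; ring.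
Qed.

Lemma adapted_t4frame_skew :
  [/\ br y (e 1%N 2%N) = - br (e 1%N 2%N) y,
      br y (e 2%N 3%N) = - br (e 2%N 3%N) y &
      br y (e 3%N 4%N) = - br (e 3%N 4%N) y] /\
  (br y (e 1%N 3%N) = - br (e 1%N 3%N) y /\
   br y (e 2%N 4%N) = - br (e 2%N 4%N) y).
Proof.
have neq (m n : int) := @numeral_neq F m n.
have x13 : br (e 1%N 3%N) x = 4 *: e 1%N 3%N.
  by rewrite t4combE br_t4comb_eigen t4combZ; congr t4comb; ring.
have x24 : br (e 2%N 4%N) x = -1 *: e 2%N 4%N.
  by rewrite t4combE br_t4comb_eigen t4combZ; congr t4comb; ring.
have x12' : br (e 1%N 2%N) x = 1 *: e 1%N 2%N by rewrite scale1r.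
split; [split | split].
- exact: adapted_skew (neq 1 0 isT) x12'.
- exact: adapted_skew (neq 3 0 isT) x23.
- exact: adapted_skew (neq (-4) 0 isT) x34.
- exact: adapted_skew (neq 4 0 isT) x13.
- exact: adapted_skew (neq (-1) 0 isT) x24.
Qed.
End Adapted.

Lemma exists_adapted_pair :
    (exists y, weight12 br e y = 1 /\ weight23 br e y = 0) ->
  exists y z, [/\ adapted y, weight12 br e y = 1 & weight23 br e y = 0] /\
    [/\ adapted z, weight12 br e z = 0 & weight23 br e z = 1].
Proof.
case=> y0 [y1 y2]; have [u uN yu] := exists_adapted y0.
have [u1 u2 _] := weight_N eN eP uN.
have three0 : (3 : F) != 0 by rewrite pnatr_eq0.
have wD i : weight br e i (y0 + u) = weight br e i y0 + weight br e i u.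
  by rewrite linearD.
have wB i : weight br e i (3^-1 *: x + - 3^-1 *: (y0 + u)) =
    3^-1 * weight br e i x - 3^-1 * weight br e i (y0 + u).
  by rewrite linearD !linearZ /= mulNr.
have w1 : weight12 br e (y0 + u) = 1.
  by rewrite /weight12 wD -/(weight12 _ _) y1 u1 addr0.
have w2 : weight23 br e (y0 + u) = 0.
  by rewrite /weight23 wD -/(weight23 _ _) y2 u2 addr0.
have x1 : weight12 br e x = 1.
  by rewrite [LHS]/weight /= x12 t4combE (coord_t4comb eN).
have x2 : weight23 br e x = 3.
  by rewrite [LHS]/weight /= x23 t4combE t4combZ (coord_t4comb eN) /= mulr1.
exists (y0 + u), (3^-1 *: x + - 3^-1 *: (y0 + u)); split; split=> //.
- by apply: adapted_lin => //; exact: adaptedx.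
- by rewrite /weight12 wB -/(weight12 _ _) x1 w1 subrr.
by rewrite /weight23 wB -/(weight23 _ _) x2 w2 mulr0 subr0 mulVf.
Qed.

Lemma t4frame_fullv y z : (forall v, null_weights br e v -> v \in N) ->
    \dim {: L} = 8%N ->
    weight12 br e y = 1 -> weight23 br e y = 0 ->
    weight12 br e z = 0 -> weight23 br e z = 1 ->
  basis_of fullv [:: e 1%N 2%N; e 2%N 3%N; e 3%N 4%N; e 1%N 3%N; e 2%N 4%N;
    e 1%N 4%N; y; z].
Proof.
move=> nullN dimL y1 y2 z1 z2.
rewrite basisEdim dimL leqnn andbT; apply/subvP => v _.
set X := [:: _; _; _; _; _; _; _; _].
have -> : v = (v - weight12 br e v *: y - weight23 br e v *: z) +
    weight23 br e v *: z + weight12 br e v *: y by rewrite !subrK.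
have yX : y \in X by rewrite !inE eqxx ?orbT.
have zX : z \in X by rewrite !inE eqxx ?orbT.
do 2![apply: memvD; last by rewrite memvZ ?memv_span].
have NX : (N <= <<X>>)%VS.
  rewrite -(span_basis eN); apply: sub_span => u; rewrite !inE.
  by do 5![case/orP=> [->|]; rewrite ?orbT //] => ->; rewrite ?orbT.
apply/(subvP NX)/nullN.
have wE i (k l : F) : weight br e i (v - k *: y - l *: z) =
    weight br e i v - k * weight br e i y - l * weight br e i z.
  by rewrite !linearB !linearZ.
have w1 : weight12 br e (v - weight12 br e v *: y - weight23 br e v *: z) = 0.
  by rewrite /weight12 wE -/(weight12 _ _) y1 z1 mulr0 mulr1 subr0 subrr.
have w2 : weight23 br e (v - weight12 br e v *: y - weight23 br e v *: z) = 0.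
  by rewrite /weight23 wE -/(weight23 _ _) y2 z2 mulr0 mulr1 subr0 subrr.
split=> //.
by have := w_sum (v - weight12 br e v *: y - weight23 br e v *: z);
   rewrite w1 w2 !add0r.
Qed.
End Eigenframe.

Section T4.
Variable F : fieldType.

Let E (i j : nat) : 'M[F]_4 := delta_mx (inord i.-1) (inord j.-1).

Lemma commutator_T4_products : T4_products (@commutator F 4) E.
Proof.
have inordE (m n : nat) :
    (1 <= m)%N -> (m <= 4)%N -> (1 <= n)%N -> (n <= 4)%N ->
    (inord m.-1 == inord n.-1 :> 'I_4) = (m == n).
  by move: m n => [|m] [|n] // _ m4 _ n4; rewrite -val_eqE /= !inordK.
move=> i j k l /andP[i1 ij] j4 /andP[k1 kl] l4.
rewrite /commutator /E !mul_delta_mx_cond !scaler_nat.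
rewrite !inordE; try lia.
by rewrite [l == i]eq_sym.
Qed.

Lemma T4_basis : basis_of (T4 F) (t4frame E).
Proof.
have sumE a b c d f g (i j : 'I_4) : t4comb E a b c d f g i j =
    nth 0 (nth [::] [:: [:: 0; a; d; g]; [:: 0; 0; b; f]; [:: 0; 0; 0; c]] i) j.
  rewrite !mxE -!val_eqE /= !inordK //.
  by move: i j => [[|[|[|[|]]]] //= ?] [[|[|[|[|]]]] //= ?];
     rewrite ?(mulr0, mulr1, addr0, add0r).
apply: t4comb_basis.
- move=> A /memv_T4 A0.
  exists (A (inord 0) (inord 1)), (A (inord 1) (inord 2)),
    (A (inord 2) (inord 3)), (A (inord 0) (inord 2)),
    (A (inord 1) (inord 3)), (A (inord 0) (inord 3)).
  apply/matrixP => i j; rewrite sumE.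
  have [ji|ij] := leqP j i.
    rewrite A0 //.
    by move: i j ji => [[|[|[|[|]]]] //= ?] [[|[|[|[|]]]] //= ?].
  rewrite -[i in LHS]inord_val -[j in LHS]inord_val.
  by move: i j ij => [[|[|[|[|]]]] //= ?] [[|[|[|[|]]]] //= ?].
- have E_T4 m n : (m.-1 < n.-1 < 4)%N -> E m n \in T4 F.
    move=> /andP[mn n4]; apply/memv_T4 => i j ji.
    rewrite mxE -!val_eqE /= !inordK ?(ltn_trans mn) //.
    by case: eqP => //= im; case: eqP => // jn; lia.
  by move=> A; rewrite !inE;
     do 5![case/orP=> [/eqP->|]; first exact: E_T4] => /eqP->; exact: E_T4.
move=> a b c d f g /matrixP T0.
have := T0 (inord 0) (inord 1); have := T0 (inord 1) (inord 2).
have := T0 (inord 2) (inord 3); have := T0 (inord 0) (inord 2).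
have := T0 (inord 1) (inord 3); have := T0 (inord 0) (inord 3).
by rewrite !sumE !mxE !inordK //= => -> -> -> -> -> ->.
Qed.

Lemma isomorphic_T4_frame (L : vectType F) (br : L -> L -> L) (N : {vspace L}) :
    isomorphic_algebras (@commutator F 4) (T4 F) br N ->
  exists e, basis_of N (t4frame e) /\ T4_products br e.
Proof.
case=> f [ker_f <- f_br]; exists (fun i j => f (E i j)); split.
  exact: limg_basis_of ker_f T4_basis.
move=> i j k l ij j4 kl l4.
rewrite -f_br; last 2 first.
- exact: (t4frame_memv T4_basis).
- exact: (t4frame_memv T4_basis).
by rewrite commutator_T4_products // linearB !linearZ.
Qed.

End T4.

Theorem theorem4p2 (R : realType) (L : vectType R[i])
    (br : {bilinear L -> L -> L}) (hL : in_L42 br) (hnonLie : ~ lie br) :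
  exists (N : nat -> nat -> L) (X1 X2 : L) (s11 s22 s12 s21 : R[i]),
    basis_of fullv
      [:: N 1%N 2%N; N 2%N 3%N; N 3%N 4%N; N 1%N 3%N; N 2%N 4%N; N 1%N 4%N;
          X1; X2] /\
    T4_products br N /\
    (br (N 1%N 2%N) X1 = N 1%N 2%N /\ br X1 (N 1%N 2%N) = - N 1%N 2%N) /\
    (br (N 2%N 3%N) X1 = 0 /\ br X1 (N 2%N 3%N) = 0) /\
    (br (N 3%N 4%N) X1 = - N 3%N 4%N /\ br X1 (N 3%N 4%N) = N 3%N 4%N) /\
    (br (N 1%N 3%N) X1 = N 1%N 3%N /\ br X1 (N 1%N 3%N) = - N 1%N 3%N) /\
    (br (N 2%N 4%N) X1 = - N 2%N 4%N /\ br X1 (N 2%N 4%N) = N 2%N 4%N) /\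
    (br (N 1%N 4%N) X1 = 0 /\ br X1 (N 1%N 4%N) = 0) /\
    (br (N 1%N 2%N) X2 = 0 /\ br X2 (N 1%N 2%N) = 0) /\
    (br (N 2%N 3%N) X2 = N 2%N 3%N /\ br X2 (N 2%N 3%N) = - N 2%N 3%N) /\
    (br (N 3%N 4%N) X2 = - N 3%N 4%N /\ br X2 (N 3%N 4%N) = N 3%N 4%N) /\
    (br (N 1%N 3%N) X2 = N 1%N 3%N /\ br X2 (N 1%N 3%N) = - N 1%N 3%N) /\
    (br (N 2%N 4%N) X2 = 0 /\ br X2 (N 2%N 4%N) = 0) /\
    (br (N 1%N 4%N) X2 = 0 /\ br X2 (N 1%N 4%N) = 0) /\
    br X1 X1 = s11 *: N 1%N 4%N /\
    br X2 X2 = s22 *: N 1%N 4%N /\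
    br X1 X2 = s12 *: N 1%N 4%N /\
    br X2 X1 = s21 *: N 1%N 4%N.
Proof.
have [brL solvL _ [N [Q [[idN _ maxN] isoN dimQ NQ NQ0]]]] := hL.
have [e0 [e0N e0P]] := isomorphic_T4_frame isoN.
have dimL : \dim {: L} = 8%N.
  by rewrite -NQ dimv_disjoint_sum // dimQ (size_basis e0N).
have [x1 [wx11 wx12]] :=
  exists_weights brL idN e0N e0P solvL maxN dimL hnonLie 1 3.
have wx13 : weight34 br e0 x1 = -4.
  have := weight_sum brL idN e0N e0P solvL maxN dimL hnonLie x1.
  by rewrite wx11 wx12 => /eqP; rewrite addrC addr_eq0 => /eqP->;
     congr (- _); ring.
have [e [eN eP [x12 x23 x34]]] :=
  exists_eigenframe brL idN e0N e0P wx11 wx12 wx13.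
have brN := br_in_N brL idN eN eP solvL maxN dimL.
have br_symE := br_sym brL idN eN eP solvL maxN dimL.
have e14r := br_e14r brL idN eN eP solvL maxN dimL hnonLie.
have w_sum := weight_sum brL idN eN eP solvL maxN dimL hnonLie.
have [X1 [X2 [[adX1 w11 w12] [adX2 w21 w22]]]] :=
  exists_adapted_pair brL idN eN eP brN br_symE w_sum x12 x23 x34
  (exists_weights brL idN eN eP solvL maxN dimL hnonLie 1 0).
have w13 : weight34 br e X1 = -1.
  by have := w_sum X1; rewrite w11 w12 addr0 addrC => /eqP;
     rewrite addr_eq0 => /eqP.
have w23 : weight34 br e X2 = -1.
  by have := w_sum X2; rewrite w21 w22 add0r addrC => /eqP;
     rewrite addr_eq0 => /eqP.
have nullN := null_weights_memv brL idN eN eP solvL maxN dimL.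
have adapted_pair := adapted_br brL idN eN eP brN e14r w_sum x12 x23 x34.
have [[a1 b1 c1] [d1 f1]] :=
  adapted_t4frame brL idN eN eP e14r w_sum x12 x23 x34 adX1.
have [[a2 b2 c2] [d2 f2]] :=
  adapted_t4frame brL idN eN eP e14r w_sum x12 x23 x34 adX2.
have [[a1' b1' c1'] [d1' f1']] :=
  adapted_t4frame_skew brL idN eN eP br_symE e14r w_sum x12 x23 x34 adX1.
have [[a2' b2' c2'] [d2' f2']] :=
  adapted_t4frame_skew brL idN eN eP br_symE e14r w_sum x12 x23 x34 adX2.
have e14l := br_e14l brL idN eN eP w_sum.
have [s11 E11] := adapted_pair _ _ adX1 adX1.
have [s22 E22] := adapted_pair _ _ adX2 adX2.
have [s12 E12] := adapted_pair _ _ adX1 adX2.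
have [s21 E21] := adapted_pair _ _ adX2 adX1.
exists e, X1, X2, s11, s22, s12, s21.
rewrite a1' b1' c1' d1' f1' a2' b2' c2' d2' f2' a1 b1 c1 d1 f1 a2 b2 c2 d2 f2.
rewrite !e14l !e14r E11 E22 E12 E21 w11 w12 w13 w21 w22 w23.
rewrite ?(add0r, addr0, subrr, scale0r, scale1r, scaleN1r, opprK, oppr0).
split; last by do !split.
exact: (t4frame_fullv eN w_sum nullN dimL w11 w12 w21 w22).
Qed.
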